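(* Let $a = a_1 \ldots a_n$ be a binary word. For $j \in \{1,2,3\}$ write $a^{(j)} = a_{j} a_{j+3} a_{j+6} \ldots$ (the word formed by the letters $a_i$ with $1\le i\le n$ and $i\equiv j \pmod 3$). Then $a$ is an escape sequence for some rotor configuration on the infinite ternary tree if and only if for each $j \in\{1,2,3\}$ and each $k \geq 2$, every subword of $a^{(j)}$ of length $2^k-1$ contains at most $2^{k-1}$ ones.
   Context: The infinite ternary tree is the infinite $3$-regular tree $T$ (every vertex has exactly $3$ neighbors), with a distinguished origin $o$. ''Subword'' means a block of consecutive letters. Rotor-router walk: for each vertex a cyclic ordering of its three neighbors is fixed, and a rotor configuration assigns to each vertex a rotor pointing to one of its neighbors. When a chip is at a vertex $v$, the rotor at $v$ first advances to the next neighbor in the cyclic ordering, and then the chip moves to the neighbor to which the new rotor points. Chips are started at $o$ one after another; each chip performs rotor-router walk until it first returns to $o$ (where it stops), or else it never returns, in which case it visits every vertex only finitely many times (''escapes to infinity''). In either case the rotor configuration after the walk is well defined (at each vertex, the final position of its rotor), and the next chip starts with that rotor configuration. A binary word $a_1\ldots a_n$ is an escape sequence for the initial rotor configuration if, for each $1\le k\le n$, the $k$-th chip escapes to infinity if and only if $a_k=1$ (and returns to $o$ if $a_k=0$). *)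

(* Defs.v *)
From mathcomp Require Import all_boot.

Set Implicit Arguments.
Unset Strict Implicit.
Unset Printing Implicit Defensive.

Definition has_degree (V : eqType) (e : rel V) (v : V) (d : nat) : Prop :=
  exists s : seq V, [/\ uniq s, size s = d & forall u, e v u = (u \in s)].

Definition connected (V : eqType) (e : rel V) : Prop :=
  forall x y, exists2 p, path e x p & last x p = y.

(* The closed walks [::] and [:: x; y] satisfy [ucycle] without being cycles
   of the graph, hence the bound 2. *)
Definition acyclic (V : eqType) (e : rel V) : Prop :=
  forall c : seq V, ucycle e c -> size c <= 2.

(* The conditions determine the graph up to isomorphism. *)
Record ternary_tree (V : eqType) (e : rel V) : Prop := TernaryTree {
  ternary_tree_sym : symmetric e;
  ternary_tree_irrefl : irreflexive e;
  ternary_tree_connected : connected e;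
  ternary_tree_acyclic : acyclic e;
  ternary_tree_regular : forall v, has_degree e v 3
}.

(* [next v u] is the successor of [u] in the cyclic ordering of the neighbors
   of [v].  Its values when [u] is not a neighbor of [v] are irrelevant. *)
Definition cyclic_ordering (V : eqType) (e : rel V) (next : V -> V -> V) :
    Prop :=
  forall v,
    (forall u, e v u -> e v (next v u)) /\
    (forall u w, e v u -> e v w -> exists k, iter k (next v) u = w).

Definition rotor_configuration (V : eqType) (e : rel V) (r : V -> V) : Prop :=
  forall v, e v (r v).

Section RotorWalk.

Variables (V : eqType) (next : V -> V -> V) (o : V).

(* A state is the position of the chip together with the rotors. *)
Definition rotor_step (s : V * (V -> V)) : V * (V -> V) :=
  let: (v, r) := s in
  let u := next v (r v) in
  (u, fun w => if w == v then u else r w).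

Definition walk (r : V -> V) (t : nat) : V * (V -> V) :=
  iter t rotor_step (o, r).

Definition position (r : V -> V) (t : nat) : V := (walk r t).1.

Definition rotors (r : V -> V) (t : nat) : V -> V := (walk r t).2.

Definition first_return (r : V -> V) (t : nat) : Prop :=
  [/\ 0 < t, position r t = o & forall s, 0 < s < t -> position r s <> o].

Definition escapes (r : V -> V) : Prop :=
  forall t, 0 < t -> position r t <> o.

(* [r'] is the rotor configuration left behind by a chip started at [o] with
   rotors [r]: the rotors at the first return, or else the final position of
   each rotor once the chip has visited its vertex for the last time. *)
Definition configuration_after (r r' : V -> V) : Prop :=
  (exists2 t, first_return r t & r' =1 rotors r t) \/
  (escapes r /\
   forall v, exists t0, forall t, t0 <= t ->
     position r t <> v /\ rotors r t v = r' v).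

(* [rs k] is the rotor configuration faced by the chip with index [k],
   chips and letters being numbered from 0. *)
Definition escape_sequence (r : V -> V) (a : seq bool) : Prop :=
  exists rs : nat -> V -> V,
    rs 0 =1 r /\
    forall k, k < size a ->
      (escapes (rs k) <-> nth false a k = true) /\
      configuration_after (rs k) (rs k.+1).

End RotorWalk.

(* With letters numbered from 0, the words a^(1), a^(2), a^(3) are
   [residue_word a 0], [residue_word a 1], [residue_word a 2]. *)
Definition residue_word (a : seq bool) (j : nat) : seq bool :=
  [seq nth false a i | i <- iota 0 (size a) & i %% 3 == j].

Definition number_of_ones (u : seq bool) : nat := count_mem true u.

(* Main.v *)
Require Import Defs.
From mathcomp Require Import all_boot.
From mathcomp Require Import boolp zify.

Set Implicit Arguments.
Unset Strict Implicit.
Unset Printing Implicit Defensive.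

(* At a vertex v other than o the rotor cycles through parent, first child,
   second child, so the word of outcomes of the chips entering the branch at v
   is a concatenation of blocks 1^(s_i) 0, where s_i = u_i + w_i and u, w are the
   words of outcomes of the two child branches; the first block may be cut
   short, depending on the initial rotor.

   Necessity is by induction on k: a window of length 2^(k+1) - 1 with more than
   2^k ones has at most 2^k - 2 zeros, hence meets at most 2^k - 1 blocks, and
   each child contributes at most 2^(k-1) ones to these.

   Conversely, in a word with the counting property any 2^k - 1 consecutive
   blocks contain at most 2^k ones.  Sharing the blocks with s_i = 1 alternately
   between the children therefore yields two words with the property again, and
   iterating this gives every vertex a word.  The initial rotor points to the
   parent if the word starts with 1 and precedes the parent otherwise.  Then a
   chip facing the letter of index n, if this is 0, only meets letters of index
   less than n at the children it visits, so it returns by induction on n; and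
   a chip facing a 1 finds a 1 at some child, over and over, so it escapes.

   The branches at the three neighbors of o take the chips in turn. *)

Implicit Types a : nat -> bool.

(** * Splitting words *)

Definition ones a (m l : nat) : nat := count a (iota m l).

(** [k.+1] is the exponent of the theorem. The additional case [k = 0] always holds and is where
    inductions start. *)
Definition sparse a : Prop := forall k m, ones a m (2 ^ k.+1 - 1) <= 2 ^ k.

Lemma ones0 a m : ones a m 0 = 0.
Proof. by []. Qed.

Lemma onesD a m l1 l2 : ones a m (l1 + l2) = ones a m l1 + ones a (m + l1) l2.
Proof. by rewrite /ones iotaD count_cat. Qed.

Lemma onesS a m l : ones a m l.+1 = ones a m l + a (m + l).
Proof. by rewrite -addn1 onesD /ones /= addn0. Qed.

Lemma ones_le a m l : ones a m l <= l.
Proof. by rewrite /ones (leq_trans (count_size _ _)) ?size_iota. Qed.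

Lemma sparse_no111 a n : sparse a -> [|| ~~ a n, ~~ a n.+1 | ~~ a n.+2].
Proof.
move=> /(_ 1 n); rewrite !onesS ones0 addn0 addn1 addn2.
by case: (a n); case: (a n.+1); case: (a n.+2).
Qed.

(** For a sparse word this is the number of ones before the next 0: by [sparse_no111] two letters
    are enough to see it. *)
Definition run a (n : nat) : nat := if a n then (if a n.+1 then 2 else 1) else 0.

(* The letters from the first round on are cut into blocks [1^s 0]; [round a i]
   is the position of the [i]-th block together with the parity of the number
   of earlier blocks with [s = 1].  A leading 0 is not part of any block: it is
   the letter produced by a rotor that initially precedes the parent. *)
Fixpoint round a (i : nat) : nat * bool :=
  if i is j.+1 then
    let: (n, b) := round a j in (n + (run a n).+1, b (+) (run a n == 1))
  else (~~ a 0 : nat, false).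

Definition split1 a (i : nat) : bool :=
  let: (n, b) := round a i in (run a n == 2) || (run a n == 1) && ~~ b.

Definition split2 a (i : nat) : bool :=
  let: (n, b) := round a i in (run a n == 2) || (run a n == 1) && b.

Lemma split_run a i : split1 a i + split2 a i = run a (round a i).1.
Proof.
rewrite /split1 /split2; case: (round a i) => n b /=.
by rewrite /run; case: (a n); case: (a n.+1); case: b.
Qed.

(** A block is one letter longer than its number of ones, and by [split_run] these ones are shared
    out between the two children. *)
Lemma split_round a i :
  (round a i).1 = ~~ a 0 + i + ones (split1 a) 0 i + ones (split2 a) 0 i.
Proof.
elim: i => [|i IH]; first by rewrite /= !addn0.
rewrite !onesS !add0n; move: IH (split_run a i) => /=.
by case: (round a i) => n b /=; lia.
Qed.

(** Blocks with a single 1 are given alternately, first to [split1], so its lead is always the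
    parity bit. *)
Lemma split_parity a i :
  ones (split1 a) 0 i = ones (split2 a) 0 i + (round a i).2.
Proof.
elim: i => [|i IH] //; rewrite !onesS !add0n /= IH /split1 /split2.
case: (round a i) => n b /=.
by rewrite /run; case: (a n); case: (a n.+1); case: b => /=; lia.
Qed.

Section Split.

Variables (a : nat -> bool) (a_sparse : sparse a).

Let start i := (round a i).1.

Lemma split1_true i : split1 a i -> a (start i).
Proof.
rewrite /start /split1; case: (round a i) => n b /=.
by rewrite /run; case: (a n).
Qed.

(** The rotor visits the first child before the second, so within a block the 1 of the second child
    comes after that of the first. *)
Lemma split2_true i : split2 a i -> a (start i + split1 a i).
Proof.
rewrite /start /split1 /split2; case: (round a i) => n b /=; rewrite /run.
case an: (a n) => //=; case an1: (a n.+1) => //=; first by rewrite addn1.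
by case: b; rewrite //= addn0.
Qed.

Lemma split_false i : a (start i + split1 a i + split2 a i) = false.
Proof.
rewrite -addnA split_run -/(start i) /run.
have := sparse_no111 (start i) a_sparse.
case an: (a (start i)); last by rewrite addn0 an.
case an1: (a (start i).+1); last by rewrite addn1 an1.
by rewrite addn2 => /negbTE.
Qed.

Lemma split_head : a 0 -> split1 a 0 || split2 a 0.
Proof.
move=> a0; have := split_false 0; rewrite /start /= a0 /=.
by case: (split1 a 0) => //=; case: (split2 a 0) => //=; rewrite a0.
Qed.

Lemma start_shift m l :
  start (m + l) = start m + l + ones (split1 a) m l + ones (split2 a) m l.
Proof. by rewrite /start !split_round !onesD !add0n; lia. Qed.

Lemma ones_rounds m l :
  ones a (start m) (l + ones (split1 a) m l + ones (split2 a) m l)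
    = ones (split1 a) m l + ones (split2 a) m l.
Proof.
elim: l => [|l IH] //.
have F := split_false (m + l); rewrite (start_shift m l) in F.
have T1 := @split1_true (m + l); rewrite (start_shift m l) in T1.
have T2 := @split2_true (m + l); rewrite (start_shift m l) in T2.
rewrite !(onesS (split1 a)) !(onesS (split2 a)).
set p := l + _ + _ in IH.
have -> : l.+1 + (ones (split1 a) m l + split1 a (m + l)) +
   (ones (split2 a) m l + split2 a (m + l)) =
   p + (split1 a (m + l) + split2 a (m + l)).+1 by rewrite /p; lia.
rewrite onesD IH.
have E : start m + l + ones (split1 a) m l + ones (split2 a) m l = start m + p.
  by rewrite /p !addnA.
rewrite {}E in F T1 T2.
case: (split1 a (m + l)) F T1 T2; case: (split2 a (m + l)) => /=;
  rewrite ?addn0 ?addn1 ?addn2 => F T1 T2;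
  rewrite !onesS ones0 ?addn0 ?addn1 ?addn2 ?F ?T2 ?T1 //=; lia.
Qed.

(** Suppose the [l] blocks hold [S > 2 ^ k.+1] ones. They fill [l + S] letters, the first
    [2 ^ k.+2 - 1] of which hold at most [2 ^ k.+1] ones. The other [d = S - 2 ^ k.+1] letters end
    with the closing 0 of the last block, so they hold fewer than [d] ones, and the total falls
    short of [S]. *)
Lemma split_window k m :
  ones (split1 a) m (2 ^ k.+1 - 1) + ones (split2 a) m (2 ^ k.+1 - 1) <= 2 ^ k.+1.
Proof.
have kP : 0 < 2 ^ k by rewrite expn_gt0.
have E1 : 2 ^ k.+1 = 2 * 2 ^ k by rewrite expnS.
have E2 : 2 ^ k.+2 = 4 * 2 ^ k by rewrite 2!expnS mulnA.
set l := 2 ^ k.+1 - 1.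
set S := ones _ m l + _; rewrite leqNgt; apply/negP => ltS.
have H := ones_rounds m l.
rewrite -addnA -/S in H.
have lS : l + S = (2 ^ k.+2 - 1) + (l + S - (2 ^ k.+2 - 1)) by rewrite /l; lia.
rewrite lS onesD in H.
have W := a_sparse k.+1 (start m).
pose d := l + S - (2 ^ k.+2 - 1).
have dP : 0 < d by rewrite /d /l; lia.
have F : a (start m + (2 ^ k.+2 - 1) + d.-1) = false.
  have F := split_false (m + l.-1).
  rewrite -{}F; congr a.
  have [l' lE] : exists l', l = l'.+1 by exists l.-1; rewrite /l; lia.
  have := start_shift m l'.
  have : S = ones (split1 a) m l' + split1 a (m + l') +
    (ones (split2 a) m l' + split2 a (m + l')) by rewrite /S lE !onesS.
  have -> : l.-1 = l' by rewrite lE.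
  by move: lE; rewrite /d /l; lia.
move: H; rewrite -/d -(prednK dP) onesS F.
have := ones_le a (start m + (2 ^ k.+2 - 1)) d.-1.
by rewrite /d /l; lia.
Qed.

(** The lead of [split1] is 0 or 1 at both ends of the window, so it changes by at most 1. *)
Lemma split_diff m l :
  ones (split1 a) m l <= (ones (split2 a) m l).+1 /\
  ones (split2 a) m l <= (ones (split1 a) m l).+1.
Proof.
have := split_parity a m; have := split_parity a (m + l).
rewrite !onesD !add0n; case: (_.2); case: (_.2); lia.
Qed.

(** The two counts differ by at most 1 and their sum is at most an even number, so neither exceeds
    half of that number. *)
Lemma sparse_split1 : sparse (split1 a).
Proof.
move=> k m; have := split_window k m; have [] := split_diff m (2 ^ k.+1 - 1).
by rewrite expnS; lia.
Qed.

Lemma sparse_split2 : sparse (split2 a).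
Proof.
move=> k m; have := split_window k m; have [] := split_diff m (2 ^ k.+1 - 1).
by rewrite expnS; lia.
Qed.

End Split.

(** The word is continued by zeros. A window overrunning its end consists of two windows of the next
    smaller length and a last letter that is a default 0, so induction bounds it. *)
Lemma sparse_word (w : seq bool) :
  (forall k, 2 <= k -> forall u, infix u w -> size u = 2 ^ k - 1 ->
     number_of_ones u <= 2 ^ (k - 1)) ->
  sparse (nth false w).
Proof.
move=> wP; elim=> [|k IH] m; first exact: ones_le.
have kP : 0 < 2 ^ k by rewrite expn_gt0.
have E1 : 2 ^ k.+1 = 2 * 2 ^ k by rewrite expnS.
have E2 : 2 ^ k.+2 = 4 * 2 ^ k by rewrite 2!expnS mulnA.
set l := 2 ^ k.+2 - 1; have [le|lt] := leqP (m + l) (size w).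
  have -> : ones (nth false w) m l = number_of_ones (take l (drop m w)).
    rewrite -(map_nth_iota false); last by lia.
    by rewrite /number_of_ones count_map; apply: eq_count => i /=; rewrite eqb_id.
  rewrite -[k.+1]/(k.+2 - 1); apply: wP => //.
    rewrite -{2}(cat_take_drop m w) -{2}(cat_take_drop l (drop m w)).
    exact: infix_infix.
  rewrite size_take size_drop -/l; clearbody l; case: ltnP => // lt.
  by apply/eqP; rewrite eqn_leq lt leq_subRL ?le // (leq_trans _ le) ?leq_addr.
have -> : l = (2 ^ k.+1 - 1 + (2 ^ k.+1 - 1)).+1 by rewrite /l; lia.
rewrite onesS onesD nth_default ?addn0; last by lia.
by have := IH m; have := IH (m + (2 ^ k.+1 - 1)); lia.
Qed.

Lemma residue_word_cons3 x y z w j : j < 3 ->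
  residue_word [:: x, y, z & w] j = nth false [:: x; y; z] j :: residue_word w j.
Proof.
move=> j3; rewrite /residue_word -[size _]/(3 + size w) iotaD filter_cat map_cat.
rewrite -[0 + 3]/(3 + 0) iotaDl filter_map -map_comp.
rewrite (@eq_filter _ _ (fun i => i %% 3 == j)); last by move=> i /=; rewrite modnDl.
by case: j j3 => [|[|[|]]].
Qed.

Lemma nth_residue_word w j i :
  j < 3 -> nth false (residue_word w j) i = nth false w (3 * i + j).
Proof.
move=> j3; have [n] := ubnP (size w); elim: n w i => // n IH w i.
case: w => [|x [|y [|z w]]] /= => [_|_|_|ltn].
- by rewrite !nth_nil.
- by case: j j3 {IH} => [|[|[|]]] //= _; case: i => [|i] //=;
    rewrite ?nth_nil // nth_default //=; lia.
- by case: j j3 {IH} => [|[|[|]]] //= _; case: i => [|i] //=;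
    rewrite ?nth_nil // nth_default //=; lia.
rewrite residue_word_cons3 //; case: i => [|i].
  by case: j j3 {IH} => [|[|[|]]].
have -> : 3 * i.+1 + j = (3 * i + j).+3 by lia.
by rewrite /= IH //; lia.
Qed.

Lemma iter_orbit (T : Type) (f : T -> T) (P : T -> Prop) x k :
  (forall y, P y -> P (f y)) -> P x -> P (iter k f x).
Proof. by move=> fP Px; elim: k => //= k; exact: fP. Qed.

(** A set closed under [next v] that contains a neighbor contains its orbit, hence all three
    neighbors; this excludes fixed points and 2-cycles. *)
Lemma next_3cycle (V : eqType) (e : rel V) next v u :
  cyclic_ordering e next -> has_degree e v 3 -> e v u ->
  [/\ uniq [:: u; next v u; next v (next v u)],
      next v (next v (next v u)) = u &
      forall w, e v w -> w \in [:: u; next v u; next v (next v u)]].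
Proof.
move=> /(_ v)[eN eI] [s [s_uniq size_s es]] eu.
set b := next v u; set c := next v b; set d := next v c.
have eb : e v b by apply: eN.
have ec : e v c by apply: eN.
have ed : e v d by apply: eN.
have small x (l : seq V) : e v x -> x \in l -> (forall y, y \in l -> next v y \in l) ->
  3 <= size l.
  move=> ex xl lN; rewrite -size_s; apply: uniq_leq_size => // y.
  rewrite -es => ey; have [k <-] := eI x y ex ey.
  exact: (@iter_orbit _ _ (fun y => y \in l)).
have neq1 x : e v x -> next v x != x.
  move=> ex; apply/eqP => xx.
  have := @small x [:: x] ex; rewrite mem_head => /(_ isT) H.
  suff: 3 <= 1 by [].
  by apply: H => y; rewrite !inE => /eqP ->; rewrite xx.
have neq2 x : e v x -> next v (next v x) != x.
  move=> ex; apply/eqP => xx.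
  have := @small x [:: x; next v x] ex; rewrite mem_head => /(_ isT) H.
  suff: 3 <= 2 by [].
  by apply: H => y; rewrite !inE => /orP[] /eqP ->; rewrite ?xx eqxx ?orbT.
have U : uniq [:: u; b; c].
  rewrite /= !inE negb_or andbT.
  by rewrite eq_sym neq1 // eq_sym neq2 // eq_sym neq1.
have [_ E] : (size [:: u; b; c] = size s) * ([:: u; b; c] =i s).
  apply: uniq_min_size => //; last by rewrite size_s.
  by move=> y; rewrite !inE -es => /or3P[] /eqP ->.
have mem w : e v w -> w \in [:: u; b; c] by rewrite es -E.
split=> //; have := mem d ed; rewrite !inE => /or3P[/eqP //|db|dc].
  by have := neq2 b eb; rewrite -/c -/d db.
by have := neq1 c ec; rewrite -/d dc.
Qed.

(** * Rooting the tree *)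

Section Rooting.

Variables (V : eqType) (e : rel V) (o : V) (treeV : ternary_tree e).

Let reach x n := exists p, [/\ path e o p, last o p = x & size p = n].

Lemma reach_min x : exists n, reach x n /\ forall m, reach x m -> n <= m.
Proof.
have [p pP px] := ternary_tree_connected treeV o x.
have ex : exists n, `[< reach x n >] by exists (size p); apply/asboolP; exists p.
exists (ex_minn ex); case: ex_minnP => n /asboolP xn nP; split=> // m xm.
by apply: nP; apply/asboolP.
Qed.

Lemma distance_from_root : exists depth : V -> nat,
  [/\ depth o = 0,
      forall x, depth x = 0 -> x = o,
      forall x y, e x y -> depth y <= (depth x).+1 &
      forall x, x != o -> exists2 y, e x y & depth x = (depth y).+1].
Proof.
have [depth dP] := choice reach_min.
exists depth; split.
- by apply/eqP; rewrite -leqn0; apply: (dP o).2; exists [::].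
- move=> x x0; have [p [_ px sp]] := (dP x).1.
  by move: sp px; rewrite x0 => /size0nil ->.
- move=> x y exy; apply: (dP y).2; have [p [pP px <-]] := (dP x).1.
  by exists (rcons p y); rewrite rcons_path pP px last_rcons size_rcons.
move=> x xo; have [p [pP px sp]] := (dP x).1.
case/lastP: p => [|p y] in pP px sp *; first by rewrite -px eqxx in xo.
move: pP px sp; rewrite rcons_path last_rcons size_rcons => /andP[pP eyx] yx sp.
rewrite {}yx in eyx; exists (last o p); first by rewrite (ternary_tree_sym treeV).
have dy : depth (last o p) <= size p by apply: (dP _).2; exists p.
have [q [qP qx qs]] := (dP (last o p)).1.
have : depth x <= (size q).+1.
  apply: (dP _).2; exists (rcons q x).
  by rewrite rcons_path last_rcons size_rcons qP qx.
lia.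
Qed.

(* Two distinct vertices of the same depth are joined below that depth, by
   following their geodesics to the root; an edge between them, or a common
   neighbor above them, would close a cycle. *)
Lemma rooting : exists (depth : V -> nat) (parent : V -> V),
  [/\ depth o = 0, forall v, v != o -> e v (parent v),
      forall v, v != o -> depth v = (depth (parent v)).+1 &
      forall v u, e v u -> (v != o /\ u = parent v) \/ (u != o /\ v = parent u)].
Proof.
have [depth [d0 d0P dS dP]] := distance_from_root.
have esym := ternary_tree_sym treeV.
(* Choice needs a value at [o] too; the parent of [o] is arbitrary. *)
have {}dP x : exists y, x != o -> e x y /\ depth x = (depth y).+1.
  by case: (eqVneq x o) => [_|/dP[y exy xy]]; [exists x | exists y].
have [parent pP] := choice dP.
exists depth, parent.
have link m : forall x y, x != y -> depth x = m -> depth y = m ->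
  exists p, [/\ path e x (rcons p y), uniq (x :: rcons p y), p != [::] &
               all (fun z => depth z < m) p].
  elim: m => [|m IH] x y xy dx dy; first by rewrite (d0P x) // (d0P y) ?eqxx in xy.
  have xo : x != o by apply/eqP => xo; rewrite xo d0 in dx.
  have yo : y != o by apply/eqP => yo; rewrite yo d0 in dy.
  have [ex dpx] := pP x xo; have [ey dpy] := pP y yo.
  have [pe|pne] := eqVneq (parent x) (parent y).
    exists [:: parent x]; split=> //=; last by rewrite andbT; lia.
      by rewrite ex pe esym ey.
    rewrite !inE negb_or xy !andbT; apply/andP; split.
      by apply/eqP => xpx; rewrite -xpx in dpx; lia.
    by rewrite pe; apply/eqP => xpx; rewrite xpx in dpy; lia.
  have [] := IH (parent x) (parent y) pne; try by lia.
  move=> p [p1 p2 _ p3]; exists (parent x :: rcons p (parent y)).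
  have A : all (fun z => depth z < m.+1) (parent x :: rcons p (parent y)).
    rewrite /= all_rcons; apply/and3P; split; [lia | lia |].
    by apply: sub_all p3 => z; apply: leqW.
  have N z : depth z = m.+1 -> z \notin parent x :: rcons p (parent y).
    by move=> dz; apply/negP => /(allP A); rewrite dz ltnn.
  split=> //.
    by rewrite rcons_path /= ex p1 last_rcons esym ey.
  rewrite cons_uniq rcons_uniq !N // mem_rcons in_cons negb_or xy N //=.
have noflat x y : e x y -> depth x <> depth y.
  move=> exy dxy; have xy : x != y.
    by apply/eqP => xy; have := ternary_tree_irrefl treeV x; rewrite {2}xy exy.
  have [p [p1 p2 p3 _]] := link _ x y xy dxy erefl.
  have := ternary_tree_acyclic treeV (c := x :: rcons p y).
  rewrite /ucycle /= rcons_path p1 last_rcons esym exy.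
  rewrite /= in p2; rewrite p2 => /(_ isT); rewrite size_rcons.
  by case: p p3 {p1 p2}.
have unique v x y : e v x -> e v y ->
    depth v = (depth x).+1 -> depth v = (depth y).+1 -> x = y.
  move=> ex ey dx dy; apply/eqP/negP => /negP xy.
  have [p [p1 p2 p3 p4]] := link (depth x) x y xy erefl ltac:(lia).
  have := ternary_tree_acyclic treeV (c := v :: x :: rcons p y).
  rewrite /ucycle [cycle _ _]/= rcons_path p1 last_rcons ex esym ey cons_uniq p2.
  have -> : v \notin x :: rcons p y.
    rewrite in_cons mem_rcons in_cons !negb_or; apply/and3P; split.
    - by apply/eqP => vx; rewrite -vx in dx; lia.
    - by apply/eqP => vx; rewrite -vx in dy; lia.
    by apply/negP => /(allP p4); lia.
  by move=> /(_ isT) /=; rewrite size_rcons.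
split=> [//|v /pP[]//|v /pP[]//|v u evu].
have D1 := dS _ _ evu.
have euv : e u v by rewrite esym.
have D2 := dS _ _ euv; have D3 := noflat _ _ evu.
have [uv|vu] := ltnP (depth u) (depth v).
  have vo : v != o by apply/eqP => vo; rewrite vo d0 in uv.
  have [ev dv] := pP v vo; left; split=> //.
  by apply: (unique v) => //; lia.
have uo : u != o by apply/eqP => uo; rewrite uo d0 in vu D3; lia.
have [ev dv] := pP u uo; right; split=> //.
by apply: (unique u) => //; lia.
Qed.

End Rooting.

(** * Walks in branches *)

Section Branches.

Variables (V : eqType) (e : rel V) (o : V) (next : V -> V -> V).
Variables (depth : V -> nat) (parent : V -> V).
Hypothesis depth_root : depth o = 0.
Hypothesis parent_edge : forall v, v != o -> e v (parent v).
Hypothesis depth_parent : forall v, v != o -> depth v = (depth (parent v)).+1.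
Hypothesis edgeP : forall v u, e v u ->
  (v != o /\ u = parent v) \/ (u != o /\ v = parent u).
Hypothesis nextP : cyclic_ordering e next.
Hypothesis degree3 : forall v, has_degree e v 3.

Implicit Types (v u c x : V) (r : V -> V).

Local Notation step := (rotor_step next).
Local Notation config := (rotor_configuration e).

Definition upd r v u : V -> V := fun w => if w == v then u else r w.

Lemma upd_eq r v u : upd r v u v = u.
Proof. by rewrite /upd eqxx. Qed.

Lemma upd_neq r v u x : x != v -> upd r v u x = r x.
Proof. by rewrite /upd => /negbTE ->. Qed.

Lemma stepE v r : step (v, r) = (next v (r v), upd r v (next v (r v))).
Proof. by []. Qed.

Lemma next_edge r v : config r -> e v (next v (r v)).
Proof. by move=> /(_ v) rv; apply: (nextP v).1. Qed.

Lemma config_upd r v u : config r -> e v u -> config (upd r v u).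
Proof. by move=> rP evu x; rewrite /upd; case: eqP => [->|_]. Qed.

Lemma config_next r v : config r -> config (upd r v (next v (r v))).
Proof. by move=> rP; apply: config_upd (next_edge v rP). Qed.

Lemma child_edge v u : e v u -> u != parent v -> u != o /\ parent u = v.
Proof. by move=> /edgeP[[_ ->]|[uo ->]]; rewrite ?eqxx. Qed.

Lemma root_child u : e o u -> u != o /\ parent u = o.
Proof. by move=> /edgeP[[/eqP]|[]]. Qed.

(** The subtree of descendants of [v]; the comparison of depths guards the truncated subtraction. *)
Definition branch v x : bool :=
  (depth v <= depth x) && (iter (depth x - depth v) parent x == v).

Lemma branch_refl v : branch v v.
Proof. by rewrite /branch leqnn subnn /=. Qed.

Lemma branch_sub c x : c != o -> branch c x -> branch (parent c) x.
Proof.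
move=> co /andP[le /eqP cx]; have dc := depth_parent co.
apply/andP; split; first by lia.
have -> : depth x - depth (parent c) = (depth x - depth c).+1 by lia.
by rewrite iterS cx.
Qed.

Lemma branch_irrefl c : c != o -> ~~ branch c (parent c).
Proof. by move=> /depth_parent dc; rewrite /branch; apply/negP => /andP[]; lia. Qed.

Lemma branch_root v : v != o -> ~~ branch v o.
Proof. by move=> /depth_parent dv; rewrite /branch depth_root dv. Qed.

Lemma branch_disjoint c c' x : c != o -> c' != o -> parent c = parent c' ->
  c != c' -> branch c x -> ~~ branch c' x.
Proof.
move=> co c'o pp cc' /andP[_ /eqP cx]; apply/negP => /andP[_ /eqP c'x].
by rewrite -cx -c'x (depth_parent co) (depth_parent c'o) pp eqxx in cc'.
Qed.

(** A chip at [v] under [r] eventually steps to the parent of [v], leaving [r'] behind. Recording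
    whole excursions instead of single steps makes inductions follow the tree rather than time. *)
Inductive ret : V -> (V -> V) -> (V -> V) -> Prop :=
| ret_up v r : next v (r v) = parent v -> ret v r (upd r v (parent v))
| ret_down v r r1 r2 :
    next v (r v) != parent v ->
    ret (next v (r v)) (upd r v (next v (r v))) r1 -> ret v r1 r2 -> ret v r r2.

Lemma ret_config v r r' : ret v r r' -> config r -> config r'.
Proof.
move=> R; elim: {v r r'}R => [v r up|v r r1 r2 _ _ IH1 _ IH2] rP.
  by apply: config_upd => //; rewrite -up; apply: next_edge.
by apply: IH2; apply: IH1; apply: config_next.
Qed.

Lemma ret_frame v r r' x :
  ret v r r' -> config r -> v != o -> ~~ branch v x -> r' x = r x.
Proof.
move=> R; elim: {v r r'}R => [v r up|v r r1 r2 down R1 IH1 _ IH2] rP vo vx.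
  by apply: upd_neq; apply: contraNneq vx => ->; apply: branch_refl.
have [uo pu] := child_edge (next_edge v rP) down.
have r1P := ret_config R1 (config_next v rP).
rewrite IH2 // IH1 ?upd_neq //; last 2 first.
- exact: config_next.
- by apply: contra vx => /(branch_sub uo); rewrite pu.
by apply: contraNneq vx => ->; apply: branch_refl.
Qed.

Lemma ret_walk v r r' : ret v r r' -> config r -> v != o ->
  exists t, iter t step (v, r) = (parent v, r') /\
            forall s, s < t -> (iter s step (v, r)).1 != o.
Proof.
move=> R; elim: {v r r'}R => [v r up|v r r1 r2 down R1 IH1 _ IH2] rP vo.
  by exists 1; split=> [|[|]//]; rewrite /= up.
have [uo pu] := child_edge (next_edge v rP) down.
have r1P := ret_config R1 (config_next v rP).
have [t1 [e1 n1]] := IH1 (config_next v rP) uo.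
have [t2 [e2 n2]] := IH2 r1P vo; rewrite pu in e1.
exists (t2 + t1).+1; split=> [|[|s] //]; rewrite iterSr stepE.
  by rewrite iterD e1.
have [/n1 //|le] := ltnP s t1.
by rewrite -(subnK le) iterD e1 ltnS ltn_add2r => /n2.
Qed.

(** Strong induction on time: a chip found outside the branch at [v] has also left the branch of the
    child it entered first, and less time remains after that excursion. *)
Lemma walk_ret t v r : v != o -> config r -> ~~ branch v (iter t step (v, r)).1 ->
  exists2 t', t' <= t &
    exists2 r', ret v r r' & iter t' step (v, r) = (parent v, r').
Proof.
have [n] := ubnP t; elim: n t v r => // n IH [|t] v r ltn vo rP out.
  by rewrite /= branch_refl in out.
have [up|down] := eqVneq (next v (r v)) (parent v).
  exists 1 => //; exists (upd r v (parent v)); first exact: ret_up.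
  by rewrite /= up.
have [uo pu] := child_edge (next_edge v rP) down.
have r1P := config_next v rP.
rewrite iterSr stepE in out.
have [|t1 le1 [r1 R1 e1]] := IH t _ _ ltn uo r1P.
  by apply: contra out => /(branch_sub uo); rewrite pu.
rewrite -(subnK le1) iterD e1 pu in out.
have [||t2 le2 [r2 R2 e2]] := IH (t - t1) v r1 _ vo _ out; first lia.
  exact: ret_config R1 r1P.
exists (t2 + t1).+1; first lia.
by exists r2; [exact: ret_down R1 R2 | rewrite iterSr stepE iterD e1 pu].
Qed.

Definition nonret v r : Prop := forall r', ~ ret v r r'.

Lemma nonret_branch v r t :
  v != o -> config r -> nonret v r -> branch v (iter t step (v, r)).1.
Proof.
by move=> vo rP N; apply/negPn/negP => /(walk_ret vo rP)[t' _ [r' /N]].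
Qed.

Definition final (s : V * (V -> V)) r : Prop :=
  forall x, exists t0, forall t, t0 <= t ->
    (iter t step s).1 <> x /\ (iter t step s).2 x = r x.

Lemma final_iter t s r : final s r <-> final (iter t step s) r.
Proof.
split=> H x; have [t0 t0P] := H x.
  by exists t0 => t' le; rewrite -iterD; apply: t0P; lia.
by exists (t0 + t) => t' le; rewrite -(@subnK t t') ?iterD; [apply: t0P|]; lia.
Qed.

Definition esc v r r' : Prop := nonret v r /\ final (v, r) r'.

(* [descends v r c rc]: a chip entering [v] under [r] reaches a child [c] of [v]
   under [rc], and then stays in the branch at [c] forever. *)
Inductive descends : V -> (V -> V) -> V -> (V -> V) -> Prop :=
| descends_here v r :
    next v (r v) != parent v ->
    nonret (next v (r v)) (upd r v (next v (r v))) ->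
    descends v r (next v (r v)) (upd r v (next v (r v)))
| descends_later v r r1 c rc :
    next v (r v) != parent v ->
    ret (next v (r v)) (upd r v (next v (r v))) r1 -> descends v r1 c rc ->
    descends v r c rc.

(** Induction on the number of turns until the rotor at [v] would point to the parent. An excursion
    that returns leaves this rotor alone, so the next move uses up one turn. *)
Lemma nonret_descends v r :
  v != o -> config r -> nonret v r -> exists c rc, descends v r c rc.
Proof.
move=> vo rP; have [k] := (nextP v).2 _ _ (next_edge v rP) (parent_edge vo).
elim: k r rP => [|k IH] r rP /= up N.
  by have := N _ (ret_up up).
have down : next v (r v) != parent v.
  by apply/eqP => E; have := N _ (ret_up E).
have [[r1 R1]|N1] := EM (exists r1, ret (next v (r v)) (upd r v (next v (r v))) r1).
  have [uo pu] := child_edge (next_edge v rP) down.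
  have r1v : r1 v = next v (r v).
    rewrite (ret_frame R1 (config_next v rP)) ?upd_eq //.
    by have := branch_irrefl uo; rewrite pu.
  have [| | |c [rc D]] := IH r1.
  - exact: ret_config R1 (config_next v rP).
  - by rewrite r1v -iterSr.
  - by move=> r2 R2; apply: (N r2); apply: ret_down R1 R2.
  by exists c, rc; apply: descends_later D.
exists (next v (r v)), (upd r v (next v (r v))); apply: descends_here => // r1 R1.
by apply: N1; exists r1.
Qed.

Lemma descendsP v r c rc : descends v r c rc -> config r -> v != o ->
  [/\ c != o, parent c = v, config rc, nonret c rc &
      exists t, iter t step (v, r) = (c, rc)].
Proof.
move=> D; elim: {v r c rc}D => [v r down N|v r r1 c rc down R1 _ IH] rP vo;
  have [uo pu] := child_edge (next_edge v rP) down;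
  have r1P := config_next v rP.
  by split=> //; exists 1.
have [co pc rcP N [t tP]] := IH (ret_config R1 r1P) vo.
split=> //; have [t1 [e1 _]] := ret_walk R1 r1P uo.
by exists (t + t1).+1; rewrite iterSr stepE iterD e1 pu.
Qed.

Lemma esc_descends v r r' : v != o -> config r -> esc v r r' ->
  exists c rc, descends v r c rc /\ esc c rc r'.
Proof.
move=> vo rP [N F]; have [c [rc D]] := nonret_descends vo rP N.
exists c, rc; split=> //; have [co pc rcP Nc [t tP]] := descendsP D rP vo.
by split=> //; rewrite -tP -final_iter.
Qed.

Lemma config_iter s t : config s.2 -> config (iter t step s).2.
Proof.
move=> sP; elim: t => //= t; case: (iter t step s) => v r /=; exact: config_next.
Qed.

Lemma nonret_deep v r m : v != o -> config r -> nonret v r ->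
  exists t c rc, [/\ iter t step (v, r) = (c, rc), c != o, config rc, nonret c rc &
                  m <= depth c].
Proof.
move=> vo rP N; elim: m => [|m [t [u [ru [tP uo ruP Nu le]]]]]; first by exists 0, v, r.
have [c [rc D]] := nonret_descends uo ruP Nu.
have [co pc rcP Nc [t' t'P]] := descendsP D ruP uo.
exists (t' + t), c, rc; split=> //; first by rewrite iterD tP.
by rewrite (depth_parent co) pc.
Qed.

(** Once the chip is confined to a branch rooted deeper than [x], it never visits [x] again and the
    rotor there is frozen. *)
Lemma final_exists v r : v != o -> config r -> nonret v r -> exists r', final (v, r) r'.
Proof.
move=> vo rP N.
have F x : exists y t0, forall t, t0 <= t ->
    (iter t step (v, r)).1 <> x /\ (iter t step (v, r)).2 x = y.
  have [t0 [c [rc [t0P co rcP Nc lt]]]] := nonret_deep (depth x).+1 vo rP N.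
  exists (rc x), t0 => t /subnK <-.
  have off t' : (iter t' step (c, rc)).1 <> x.
    move=> tx; have := nonret_branch t' co rcP Nc; rewrite tx => /andP[]; lia.
  rewrite iterD t0P; split=> //; elim: (t - t0) => //= t' IH.
  case: (iter t' step (c, rc)) (off t') IH => w s /= wx IH.
  by rewrite -IH; case: eqP => // xw; case: wx.
have [r' r'P] := choice F; by exists r'.
Qed.

Lemma esc_exists v r : v != o -> config r -> nonret v r -> exists r', esc v r r'.
Proof. by move=> vo rP N; have [r' F] := final_exists vo rP N; exists r'. Qed.

Lemma esc_config v r r' : config r -> esc v r r' -> config r'.
Proof.
move=> rP [_ F] x; have [t0 t0P] := F x; have [_ <-] := t0P _ (leqnn t0).
exact: config_iter.
Qed.

Lemma esc_frame v r r' x :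
  esc v r r' -> config r -> v != o -> ~~ branch v x -> r' x = r x.
Proof.
move=> [N F] rP vo vx; have [t0 t0P] := F x; have [_ <-] := t0P _ (leqnn t0).
elim: t0 {t0P} => //= t IH; have := nonret_branch t vo rP N.
case: (iter t step (v, r)) IH => w s /= IH vw.
by rewrite -IH; case: eqP => // xw; rewrite xw vw in vx.
Qed.

Definition outcome v r (b : bool) r' : Prop := if b then esc v r r' else ret v r r'.

Lemma outcome_config v r b r' : outcome v r b r' -> config r -> config r'.
Proof. by case: b => [/esc_config|/ret_config] H // rP; apply: H. Qed.

Lemma outcome_frame v r b r' x :
  outcome v r b r' -> config r -> v != o -> ~~ branch v x -> r' x = r x.
Proof. by case: b; [apply: esc_frame | apply: ret_frame]. Qed.

(** * The walk of one chip started at the origin *)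

Section Root.

Variables (r : V -> V) (rP : config r).
Let u := next o (r o).
Let r1 := upd r o u.

Let r1P : config r1. Proof. exact: config_next. Qed.
Let uP : u != o /\ parent u = o. Proof. by apply: root_child; apply: next_edge. Qed.

Lemma walkS t : walk next o r t.+1 = iter t step (u, r1).
Proof. by rewrite /walk iterSr. Qed.

Lemma first_return_ret t : first_return next o r t -> ret u r1 (rotors next o r t).
Proof.
have [uo pu] := uP; case: t => [|t] [] //; rewrite /position /rotors => _ to ts.
move: to; rewrite walkS => to.
have [|t' le [r' R E]] := walk_ret (t := t) uo r1P; first by rewrite to branch_root.
have [<-|ne] := eqVneq t' t; first by rewrite E.
(* Leaving the branch before time [t] would be an earlier return to [o]. *)
by case: (ts t'.+1); [lia | rewrite walkS E].
Qed.

Lemma ret_first_return r' : ret u r1 r' ->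
  exists2 t, first_return next o r t & rotors next o r t = r'.
Proof.
have [uo pu] := uP => R; have [t [tP ts]] := ret_walk R r1P uo.
exists t.+1; last by rewrite /rotors walkS tP.
split=> //; first by rewrite /position walkS tP.
by case=> // s /ts /eqP; rewrite /position walkS.
Qed.

Lemma escapesP : escapes next o r <-> nonret u r1.
Proof.
have [uo pu] := uP; split=> [E r' /ret_first_return[t [t0 to _] _]|N [|t] // _].
  exact: E to.
rewrite /position walkS => to; have := nonret_branch t uo r1P N.
by rewrite to (negbTE (branch_root uo)).
Qed.

Lemma final_walk r' : final (u, r1) r' <->
  forall v, exists t0, forall t, t0 <= t ->
     position next o r t <> v /\ rotors next o r t v = r' v.
Proof. exact: iff_sym (final_iter 1 (o, r) r'). Qed.

(** Translates the definitions in terms of time into [outcome] at the neighbor of [o] that the chip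
    enters first. *)
Lemma configuration_afterP b r' :
  (escapes next o r <-> b = true) /\ configuration_after next o r r' <->
  outcome u r1 b r'.
Proof.
rewrite escapesP; split.
  case: b => -[N] [[t tR E]|[E F]] /=.
  - have R := first_return_ret tR; by case: (N.2 erefl _ R).
  - by split; [apply: N.2 | apply/final_walk].
  - by have R := first_return_ret tR; rewrite (funext E).
  by have /N := escapesP.1 E.
case: b => /= [[N F]|R].
  by split=> //; right; split; [apply/escapesP | apply/final_walk].
split; first by split=> // /(_ _ R).
by left; have [t tR <-] := ret_first_return R; exists t.
Qed.

End Root.

(** * Words of outcomes *)

Definition child1 v : V := next v (parent v).
Definition child2 v : V := next v (child1 v).

Lemma neighbors v : v != o ->
  [/\ child1 v != parent v, child2 v != parent v, child1 v != child2 v,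
      next v (child2 v) = parent v &
      forall u, e v u -> [\/ u = parent v, u = child1 v | u = child2 v]].
Proof.
move=> vo; have [] := next_3cycle nextP (degree3 v) (parent_edge vo).
rewrite -/(child1 v) -/(child2 v) /= !inE !negb_or !andbT.
move=> /andP[/andP[p1 p2] p3] c mem.
rewrite eq_sym p1 eq_sym p2 p3 c; split=> // u /mem; rewrite !inE.
by case/or3P => /eqP; [constructor 1 | constructor 2 | constructor 3].
Qed.

Lemma child1P v : v != o -> [/\ child1 v != o, parent (child1 v) = v & e v (child1 v)].
Proof.
move=> vo; have ev : e v (child1 v) by apply: (nextP v).1 (parent_edge vo).
by have [] := child_edge ev; have [] := neighbors vo.
Qed.

Lemma child2P v : v != o -> [/\ child2 v != o, parent (child2 v) = v & e v (child2 v)].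
Proof.
move=> vo; have [_ _ ev1] := child1P vo.
have ev : e v (child2 v) by apply: (nextP v).1 ev1.
by have [] := child_edge ev; have [] := neighbors vo.
Qed.

Lemma child1_off v : v != o -> ~~ branch (child1 v) v.
Proof. by move=> /child1P[co pc _]; have := branch_irrefl co; rewrite pc. Qed.

Lemma child2_off v : v != o -> ~~ branch (child2 v) v.
Proof. by move=> /child2P[co pc _]; have := branch_irrefl co; rewrite pc. Qed.

Lemma child12_off v x : v != o -> branch (child1 v) x -> ~~ branch (child2 v) x.
Proof.
move=> vo; have [c1 p1 _] := child1P vo; have [c2 p2 _] := child2P vo.
by apply: branch_disjoint => //; [rewrite p1 | have [] := neighbors vo].
Qed.

Lemma child21_off v x : v != o -> branch (child2 v) x -> ~~ branch (child1 v) x.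
Proof. by move=> vo; apply: contraL => /child12_off; apply. Qed.

Lemma branch_child1 v x : v != o -> branch (child1 v) x -> branch v x.
Proof. by move=> /child1P[co pc _] /(branch_sub co); rewrite pc. Qed.

Lemma branch_child2 v x : v != o -> branch (child2 v) x -> branch v x.
Proof. by move=> /child2P[co pc _] /(branch_sub co); rewrite pc. Qed.

(* [feed v r l]: chips successively entering [v], the first one under [r],
   have the outcomes [l] when the rotors outside the branch at [v] may be
   changed in between. *)
Inductive feed v : (V -> V) -> seq bool -> Prop :=
| feed_nil r : feed v r [::]
| feed_cons r r0 r1 b l :
    config r0 -> (forall x, branch v x -> r x = r0 x) -> outcome v r0 b r1 ->
    feed v r1 l -> feed v r (b :: l).

Lemma feed_eq v r r' l :
  (forall x, branch v x -> r' x = r x) -> feed v r l -> feed v r' l.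
Proof.
move=> rr' F; case: F rr' => [?|r2 r0 r1 b {}l r0P r20 out F] rr'.
  exact: feed_nil.
by apply: feed_cons out F => // x vx; rewrite rr' // r20.
Qed.

Lemma feed_inv v r b l : feed v r (b :: l) -> exists r0 r1,
  [/\ config r0, forall x, branch v x -> r x = r0 x, outcome v r0 b r1 & feed v r1 l].
Proof.
move E: (b :: l) => l0 F.
by case: F E => // {}r r0 r1 b' l' r0P rr0 out F [-> ->]; exists r0, r1.
Qed.

Lemma feed_catr v r l1 l2 : feed v r (l1 ++ l2) -> exists r', feed v r' l2.
Proof.
elim: l1 r => [|b l1 IH] r /=; first by exists r.
by move=> /feed_inv[r0 [r1 [_ _ _ /IH]]].
Qed.

Lemma feed_catl v r l1 l2 : feed v r (l1 ++ l2) -> feed v r l1.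
Proof.
elim: l1 r => [|b l1 IH] r /=; first by move=> _; apply: feed_nil.
move=> /feed_inv[r0 [r1 [r0P rr0 out /IH F]]].
exact: feed_cons out F.
Qed.

(* Each chip leaving the branch at [v] uses up one turn of the rotor at [v],
   which visits each child once. *)
Definition balanced v r (l : seq bool) : Prop := exists l1 l2,
  [/\ feed (child1 v) r l1, feed (child2 v) r l2,
      count_mem true l = count_mem true l1 + count_mem true l2,
      size l1 + (r v != parent v) <= (count_mem false l).+1 &
      size l2 + (r v == child2 v) <= (count_mem false l).+1].

(** In [balanced], the terms [r v != parent v] and [r v == child2 v] record whether the first and
    the second child have been visited in the current turn. When the rotor reaches the parent they
    become 0, and the new letter 0 pays for their earlier values. *)
Lemma balanced_up v r l : v != o -> config r -> next v (r v) = parent v ->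
  balanced v (upd r v (parent v)) l -> balanced v r (false :: l).
Proof.
move=> vo rP up [l1 [l2 [F1 F2 E S1 S2]]]; exists l1, l2.
rewrite upd_eq eqxx /= in S1.
have off x : x != v -> r x = upd r v (parent v) x by move=> /upd_neq ->.
have {}S2 := leq_trans (leq_addr _ _) S2.
have B1 : (r v != parent v : nat) <= 1 := leq_b1 _.
have B2 : (r v == child2 v : nat) <= 1 := leq_b1 _.
split=> //=; try by move: B1 B2 S1 S2; do ![case: (_ == _)] => /=; lia.
- apply: feed_eq F1 => x vx; apply: off.
  by apply: contraTneq vx => ->; apply: child1_off.
- apply: feed_eq F2 => x vx; apply: off.
  by apply: contraTneq vx => ->; apply: child2_off.
Qed.

(** A chip escaping through a child also escapes at [v], while one that returns from the child is
    still at [v]; hence a letter is added only if [b] holds. The child's new letter is paid for by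
    the term recording its visit. *)
Lemma balanced_down v r b r1 l : v != o -> config r -> next v (r v) != parent v ->
  outcome (next v (r v)) (upd r v (next v (r v))) b r1 ->
  balanced v r1 l -> balanced v r (nseq b true ++ l).
Proof.
move=> vo rP down out [l1 [l2 [F1 F2 E S1 S2]]].
have [n1 n2 n12 nc mem] := neighbors vo.
have [co1 p1 _] := child1P vo; have [co2 p2 _] := child2P vo.
have r1P := config_next v rP.
have [uo pu] := child_edge (next_edge v rP) down.
have r1v : r1 v = next v (r v).
  rewrite (outcome_frame out r1P uo) ?upd_eq //.
  by have := branch_irrefl uo; rewrite pu.
have cnt0 : count_mem false (nseq b true ++ l) = count_mem false l.
  by rewrite count_cat; case: (b).
have cnt1 : count_mem true (nseq b true ++ l) = b + count_mem true l.
  by rewrite count_cat; case: (b).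
have off1 x : branch (child1 v) x -> x != v.
  by move=> vx; apply: contraTneq vx => ->; apply: child1_off.
have off2 x : branch (child2 v) x -> x != v.
  by move=> vx; apply: contraTneq vx => ->; apply: child2_off.
rewrite /balanced cnt0 cnt1 E.
case: (mem _ (rP v)) => rv.
- rewrite rv -/(child1 v) in out r1v uo down r1P.
  rewrite r1v n1 (negbTE n12) /= in S1 S2.
  exists (b :: l1), l2.
  split; rewrite ?rv ?eqxx 1?[_ == child2 v]eq_sym ?(negbTE n2) /= //.
  + by apply: feed_cons out F1 => // x vx; rewrite upd_neq // off1.
  + apply: feed_eq F2 => x vx; rewrite (outcome_frame out) ?upd_neq ?off2 //.
    exact: child21_off.
  + by clear; case: b; lia.
  + by move: S1 S2; clear; lia.
- rewrite rv -/(child2 v) in out r1v uo down r1P.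
  rewrite r1v n2 eqxx /= in S1 S2.
  exists l1, (b :: l2); split; rewrite ?rv ?n1 ?(negbTE n12) /= //.
  + apply: feed_eq F1 => x vx; rewrite (outcome_frame out) ?upd_neq ?off1 //.
    exact: child12_off.
  + by apply: feed_cons out F2 => // x vx; rewrite upd_neq // off2.
  + by clear; case: b; lia.
  + by move: S1 S2; clear; lia.
by rewrite rv nc eqxx in down.
Qed.

Lemma balanced_ret v r r1 l : v != o -> config r -> ret v r r1 ->
  balanced v r1 l -> balanced v r (false :: l).
Proof.
move=> vo rP R; elim: {v r r1}R vo rP => [v r up|v r r1 r2 down R1 _ _ IH2] vo rP B.
  exact: balanced_up B.
apply: (@balanced_down _ _ false r1 (false :: l)) => //.
by apply: IH2 => //; apply: ret_config R1 (config_next v rP).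
Qed.

Lemma balanced_esc v r r1 l : v != o -> config r -> esc v r r1 ->
  balanced v r1 l -> balanced v r (true :: l).
Proof.
move=> vo rP /(esc_descends vo rP)[c [rc [D Ec]]] B.
elim: {v r c rc}D vo rP Ec B => [v r down N|v r r2 c rc down R1 _ IH] vo rP Ec B.
  exact: (@balanced_down _ _ true r1 l).
apply: (@balanced_down _ _ false r2 (true :: l)) => //.
by apply: IH => //; apply: ret_config R1 (config_next v rP).
Qed.

Lemma feed_balanced v r l : v != o -> config r -> feed v r l -> balanced v r l.
Proof.
move=> vo rP F; elim: F rP => {r l}[r|r r0 r1 b l r0P rr0 out _ IH] rP.
  exists [::], [::]; by split=> //; first [exact: feed_nil | exact: leq_b1].
have {IH} : balanced v r0 (b :: l).
  have B := IH (outcome_config out r0P).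
  case: (b) out => out; [exact: balanced_esc out B | exact: balanced_ret out B].
move=> [l1 [l2 [F1 F2 E S1 S2]]]; exists l1, l2; rewrite rr0 ?branch_refl //.
split=> //; [apply: feed_eq F1 | apply: feed_eq F2] => x vx; apply: rr0.
  exact: branch_child1.
exact: branch_child2.
Qed.

(** The length is bounded rather than prescribed because the words of the children obtained from
    [feed_balanced] only have bounded length. *)
Lemma feed_bound k v r l :
  v != o -> feed v r l -> size l < 2 ^ k.+1 -> count_mem true l <= 2 ^ k.
Proof.
elim: k v r l => [|k IH] v r l vo F.
  by move=> lt; rewrite (leq_trans (count_size _ _)).
(* Only [r0], under which the first chip enters, is known to be a rotor configuration, so the same
   word is fed from [r0]. *)
case: F => [?|{}r r0 r1 b {}l r0P rr0 out F]; first by rewrite expn_gt0.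
have {}F : feed v r0 (b :: l) by apply: feed_cons out F.
move: (b :: l) F => {b out}l F lt.
have [l1 [l2 [F1 F2 E S1 S2]]] := feed_balanced vo r0P F.
have [c1 _ _] := child1P vo; have [c2 _ _] := child2P vo.
have cT : count_mem false l + count_mem true l = size l.
  rewrite -(count_predC (pred1 true)) addnC; congr (_ + _).
  by apply: eq_count => -[].
have E1 : 2 ^ k.+1 = 2 * 2 ^ k by rewrite expnS.
have E2 : 2 ^ k.+2 = 4 * 2 ^ k by rewrite 2!expnS mulnA.
rewrite leqNgt; apply/negP => lt1.
have H1 : count_mem true l1 <= 2 ^ k by apply: IH F1 _ => //; lia.
have H2 : count_mem true l2 <= 2 ^ k by apply: IH F2 _ => //; lia.
lia.
Qed.

Lemma feed_infix v r l (w : seq bool) k : v != o -> feed v r l -> infix w l ->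
  size w = 2 ^ k.+1 - 1 -> count_mem true w <= 2 ^ k.
Proof.
move=> vo F /infixP[l1 [l3 E]] sw; rewrite {}E in F.
have [r' /feed_catl F'] := feed_catr F.
by apply: feed_bound F' _ => //; rewrite sw subn1 prednK // expn_gt0.
Qed.

(** * Rotors with prescribed outcomes *)

Implicit Type P : V -> (nat -> bool) -> nat -> (V -> V) -> Prop.

(** The equation for [n] is [split_round] for a possibly unfinished block: [i] exceeds [j] just
    after a visit to the first child, and while the rotor is away from the parent the pending 0 is
    already counted. *)
Definition emits_step P v (a : nat -> bool) n r : Prop := exists i j,
  [/\ j + (r v == child1 v) = i,
      ~~ a 0 + i + ones (split1 a) 0 i + ones (split2 a) 0 j = n + (r v != parent v),
      P (child1 v) (split1 a) i r & P (child2 v) (split2 a) j r].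

(* [emits v a n r]: under [r] the branch at [v] is in a state it can reach after
   producing the first [n] letters of [a], its children having produced
   [i] and [j] letters of the two words into which [a] splits, and so on
   downwards.  This is the greatest fixed point of [emits_step]. *)
Definition emits v a n r : Prop :=
  exists2 P, P v a n r & forall v a n r, v != o -> P v a n r -> emits_step P v a n r.

Lemma emits_step_mono P (Q : V -> (nat -> bool) -> nat -> (V -> V) -> Prop) v a n r :
  (forall c b k, P c b k r -> Q c b k r) ->
  emits_step P v a n r -> emits_step Q v a n r.
Proof. by move=> PQ [i [j [ij nE P1 P2]]]; exists i, j; split=> //; apply: PQ. Qed.

Lemma emits_unfold v a n r : v != o -> emits v a n r -> emits_step emits v a n r.
Proof.
move=> vo [P Pv PP]; have := PP _ _ _ _ vo Pv.
by apply: emits_step_mono => c b k Pc; exists P.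
Qed.

(** Coinduction up to [emits], so that a child on which the invariant is already known need not
    satisfy [P]. *)
Lemma emits_coind P v a n r :
  (forall v a n r, v != o -> P v a n r ->
     emits_step (fun v a n r => P v a n r \/ emits v a n r) v a n r) ->
  P v a n r -> emits v a n r.
Proof.
move=> PP Pv; exists (fun v a n r => P v a n r \/ emits v a n r); first by left.
move=> {Pv}v {}a {}n {}r vo [/(PP _ _ _ _ vo)//|/(emits_unfold vo)].
by apply: emits_step_mono; right.
Qed.

Lemma emits_fold v a n r : emits_step emits v a n r -> emits v a n r.
Proof.
move=> E; apply: (@emits_coind (emits_step emits)) E => {}v {}a {}n {}r _.
by apply: emits_step_mono; right.
Qed.

Lemma emits_eq v a n r r' :
  v != o -> (forall x, branch v x -> r' x = r x) -> emits v a n r -> emits v a n r'.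
Proof.
move=> vo rr' E.
pose P v a n r' := exists r, (forall x, branch v x -> r' x = r x) /\ emits v a n r.
apply: (@emits_coind P); last by exists r.
move=> {E rr'}v {}a {}n {}r' {}vo [{}r [rr' /(emits_unfold vo)[i [j [ij nE E1 E2]]]]].
exists i, j; rewrite rr' ?branch_refl //.
by split=> //; left; exists r; split=> // x vx; apply: rr';
  [apply: branch_child1 | apply: branch_child2].
Qed.

Section Moves.

Variables (v : V) (a : nat -> bool) (n : nat) (r : V -> V).
Hypotheses (vo : v != o) (rP : config r) (a_sparse : sparse a) (E : emits v a n r).

Lemma emits_up : next v (r v) = parent v ->
  a n = false /\ emits v a n.+1 (upd r v (parent v)).
Proof.
move=> up; have [i [j [ij nE E1 E2]]] := emits_unfold vo E.
have [n1 n2 n12 nc mem] := neighbors vo.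
have rv : r v = child2 v.
  case: (mem _ (rP v)) => // rv; rewrite rv in up.
    by rewrite /child1 up eqxx in n1.
  by rewrite /child2 up eqxx in n2.
rewrite rv eq_sym (negbTE n12) addn0 in ij; subst j; rewrite rv n2 /= addn1 in nE.
split.
  (* For [i = 0] the letter is the leading 0, otherwise the closing 0 of the last block. *)
  case: i E1 E2 nE => [|i] _ _.
    rewrite !ones0 !addn0; case a0: (a 0) => //=. by move=> [<-].
  rewrite !onesS !add0n => nE; rewrite -(split_false a_sparse i); congr a.
  by rewrite split_round; lia.
apply: emits_fold; exists i, i; rewrite upd_eq eqxx addn0 eq_sym (negbTE n1) addn0.
split=> //.
- apply: emits_eq E1; first by have [] := child1P vo.
  by move=> z vz; apply: upd_neq; apply: contraTneq vz => ->; apply: child1_off.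
- apply: emits_eq E2; first by have [] := child2P vo.
  by move=> z vz; apply: upd_neq; apply: contraTneq vz => ->; apply: child2_off.
Qed.

(** The child visited next faces its letter [b k]. The bound [k < n] makes the induction in
    [ret_exists] well-founded; the last clause allows any [P] so that it serves both inductions with
    [emits] and the coinduction in [esc_emits]. *)
Lemma emits_down (u := next v (r v)) : u != parent v -> exists b k,
  [/\ sparse b, emits u b k (upd r v u), b k -> a n, a n = false -> k < n &
      forall P r1, r1 v = u -> (forall x, x != v -> ~~ branch u x -> r1 x = r x) ->
        P u b k.+1 r1 -> (forall c b k, emits c b k r1 -> P c b k r1) ->
        emits_step P v a (n + b k) r1].
Proof.
rewrite {}/u => down; have [i [j [ij nE E1 E2]]] := emits_unfold vo E.
have [n1 n2 n12 nc mem] := neighbors vo.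
have [c1 p1 _] := child1P vo; have [c2 p2 _] := child2P vo.
have off1 x : branch (child1 v) x -> x != v.
  by move=> vx; apply: contraTneq vx => ->; apply: child1_off.
have off2 x : branch (child2 v) x -> x != v.
  by move=> vx; apply: contraTneq vx => ->; apply: child2_off.
have head := split_head a_sparse.
have Rj := split_round a j.
have T1 := @split1_true a j; have T2 := @split2_true a j.
case: (mem _ (rP v)) => rv; last by rewrite rv nc eqxx in down.
- rewrite rv in down *; rewrite -/(child1 v) in down *.
  rewrite rv eq_sym (negbTE n1) addn0 in ij; subst j.
  rewrite rv eqxx addn0 in nE; rewrite nE in Rj; rewrite Rj in T1.
  exists (split1 a), i; split=> //.
  + exact: sparse_split1.
  + by apply: emits_eq E1 => // x vx; rewrite upd_neq ?off1.
  (* Beyond the zeros of the finished blocks, [n] counts a leading 0 or, by [split_head], a 1 of the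
     first block; if neither has been produced, then [n = 0] and the letter is 1. *)
  + move=> an; move: head nE; case a0: (a 0) => /=; last first.
    by move=> _ nE; move: nE; clear; lia.
    case: i {E1 E2 Rj T1 T2} => [_ /=|i].
      by rewrite !ones0 => n0; rewrite -n0 a0 in an.
    move=> /(_ isT) /orP[] h; rewrite -(add1n i) !onesD /ones /= h;
      clear; lia.
  move=> P r1 r1v fr P1 PE; exists i.+1, i; rewrite r1v eqxx n1.
  split=> //; first by rewrite addn1.
    by rewrite onesS add0n /=; move: nE; clear; lia.
  apply: PE; apply: emits_eq E2 => // x vx; rewrite fr ?off2 //.
  exact: child21_off.
rewrite rv in down *; rewrite -/(child2 v) in down *.
rewrite rv eqxx in ij; subst i; rewrite rv n1 /= !addn1 onesS add0n in nE.
rewrite /= addn1 in E1.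
have nE' : (round a j).1 + split1 a j = n by move: Rj nE; clear; lia.
rewrite nE' in T2.
exists (split2 a), j; split=> //.
+ exact: sparse_split2.
+ by apply: emits_eq E2 => // x vx; rewrite upd_neq ?off2.
+ move=> an; move: head nE; case a0: (a 0) => /=; last first.
    by move=> _ nE; move: nE; clear; lia.
  case: j {E1 E2 Rj T1 T2} nE' => [nE'|j nE'].
    move=> /(_ isT); rewrite !ones0; case: (split1 a 0) => /=; first by clear; lia.
    move=> _ n0; suff n0' : n = 0 by rewrite n0' a0 in an.
    by move: n0; clear; lia.
  move=> /(_ isT) /orP[] h; rewrite -(add1n j) !onesD /ones /= h;
    clear; lia.
move=> P r1 r1v fr P2 PE; exists j.+1, j.+1; rewrite r1v eq_sym (negbTE n12) n2.
split=> //; first by rewrite addn0.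
  by rewrite !onesS !add0n /=; move: nE; clear; lia.
apply: PE; apply: emits_eq E1 => // x vx; rewrite fr ?off1 //.
exact: child12_off.
Qed.

End Moves.

Lemma branch_child v u : v != o -> e v u -> u != parent v -> u != o /\ ~~ branch u v.
Proof.
move=> vo evu down; have [uo pu] := child_edge evu down.
by have := branch_irrefl uo; rewrite pu.
Qed.

Lemma ret_emits v a n r r' : v != o -> config r -> sparse a -> ret v r r' ->
  emits v a n r -> a n = false /\ emits v a n.+1 r'.
Proof.
move=> vo rP aP R.
elim: {v r r'}R vo rP a n aP => [v r up|v r r1 r2 down R1 IH1 _ IH2] vo rP a n aP E.
  exact: emits_up up.
have r1P := config_next v rP.
have [uo uv] := branch_child vo (next_edge v rP) down.
have [b [k [bP Eu _ _ H]]] := emits_down vo rP aP E down.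
have [bk Eu1] := IH1 uo r1P _ _ bP Eu.
have {}H := H emits r1; rewrite bk addn0 in H.
apply: IH2 => //; first exact: ret_config R1 r1P.
apply/emits_fold/H => // [|x xv xu].
  by rewrite (ret_frame R1 r1P uo uv) upd_eq.
by rewrite (ret_frame R1 r1P uo xu) upd_neq.
Qed.

Lemma ret_exists v a n r : v != o -> config r -> sparse a -> emits v a n r ->
  a n = false -> exists r', ret v r r'.
Proof.
have [m] := ubnP n; elim: m v a n r => // m IH v a n r ltn vo rP aP E an.
(* The inner induction is on the number of turns until the rotor at [v] points to the parent. *)
have [k] := (nextP v).2 _ _ (next_edge v rP) (parent_edge vo).
elim: k r rP E => [|k IHk] r rP E /= up.
  by exists (upd r v (parent v)); apply: ret_up.
have [up'|down] := eqVneq (next v (r v)) (parent v).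
  by exists (upd r v (parent v)); apply: ret_up.
have r1P := config_next v rP.
have [uo uv] := branch_child vo (next_edge v rP) down.
have [b [j [bP Eu bj /(_ an) lt H]]] := emits_down vo rP aP E down.
have {}bj : b j = false by apply/negP => /bj; rewrite an.
have [r1 R1] := IH _ _ _ _ (leq_trans lt ltn) uo r1P bP Eu bj.
have [_ Eu1] := ret_emits uo r1P bP R1 Eu.
have r1v : r1 v = next v (r v) by rewrite (ret_frame R1 r1P uo uv) upd_eq.
have E1 : emits v a n r1.
  have {}H := H emits r1; rewrite bj addn0 in H.
  by apply/emits_fold/H => // x xv xu; rewrite (ret_frame R1 r1P uo xu) upd_neq.
have [|r2 R2] := IHk r1 (ret_config R1 r1P) E1; first by rewrite r1v -iterSr.
by exists r2; apply: ret_down R1 R2.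
Qed.

(** An escaping chip changes rotors along an infinite path, hence coinduction: after finitely many
    returns it escapes through one child, whose letter must be 1 by [ret_exists], and the claim for
    that child is of the same kind. *)
Lemma esc_emits v a n r r' : v != o -> config r -> sparse a -> esc v r r' ->
  emits v a n r -> emits v a n.+1 r'.
Proof.
pose P v a n r' := exists m r,
  [/\ n = m.+1, config r, sparse a, esc v r r' & emits v a m r].
move=> vo rP aP Ev E; apply: (@emits_coind P); last by exists n, r.
move=> {vo rP aP Ev E}v {}a _ {}r' vo [{}n [{}r [-> rP aP Ev E]]].
have [c [rc [D Ec]]] := esc_descends vo rP Ev.
elim: {v r c rc}D vo rP E Ec {Ev} => [v r down N|v r r1 c rc down R1 _ IH] vo rP E Ec;
  have r1P := config_next v rP;
  have [uo uv] := branch_child vo (next_edge v rP) down;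
  have [b [k [bP Eu _ _ H]]] := emits_down vo rP aP E down.
  have bk : b k.
    by apply/negPn/negP => /negbTE bk; have [s /N] := ret_exists uo r1P bP Eu bk.
  rewrite bk addn1 in H; apply: H.
  - by rewrite (esc_frame Ec r1P uo uv) upd_eq.
  - by move=> x xv xu; rewrite (esc_frame Ec r1P uo xu) upd_neq.
  - by left; exists k, (upd r v (next v (r v))).
  - by right.
have [bk Eu1] := ret_emits uo r1P bP R1 Eu.
have {}H := H emits r1; rewrite bk addn0 in H.
apply: IH Ec => //; first exact: ret_config R1 r1P.
apply/emits_fold/H => // [|x xv xu].
  by rewrite (ret_frame R1 r1P uo uv) upd_eq.
by rewrite (ret_frame R1 r1P uo xu) upd_neq.
Qed.

(** By [ret_emits] a return forces the letter 0, so a chip facing a 1 escapes; a chip facing a 0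
    returns by [ret_exists]. *)
Lemma emits_outcome v a n r : v != o -> config r -> sparse a -> emits v a n r ->
  exists r', outcome v r (a n) r' /\ emits v a n.+1 r'.
Proof.
move=> vo rP aP E; case an: (a n); last first.
  have [r' R] := ret_exists vo rP aP E an.
  by exists r'; split=> //; have [] := ret_emits vo rP aP R E.
have [r' Ev] : exists r', esc v r r'.
  by apply: esc_exists => // s R; have [] := ret_emits vo rP aP R E; rewrite an.
by exists r'; split=> //; apply: esc_emits Ev E.
Qed.

(** * The words at all vertices and the initial rotors *)

Section InitialRotors.

Variables (base : V -> nat -> bool) (w0 : V).
Hypothesis w0P : e o w0.

Fixpoint word_at (d : nat) v : nat -> bool :=
  if d is d'.+1 then
    if v == child1 (parent v) then split1 (word_at d' (parent v))
    else split2 (word_at d' (parent v))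
  else base v.

(** The given words sit at depth 1, at the neighbors of [o], whence the predecessor. *)
Definition word v : nat -> bool := word_at (depth v).-1 v.

Definition initial_rotors v : V :=
  if v == o then w0 else if word v 0 then parent v else child2 v.

Lemma word_child1 v : v != o -> word (child1 v) = split1 (word v).
Proof.
move=> vo; have [co pc _] := child1P vo.
by rewrite /word (depth_parent co) pc (depth_parent vo) /= pc eqxx.
Qed.

Lemma word_child2 v : v != o -> word (child2 v) = split2 (word v).
Proof.
move=> vo; have [co pc _] := child2P vo; have [_ _ n12 _ _] := neighbors vo.
by rewrite /word (depth_parent co) pc (depth_parent vo) /= pc eq_sym (negbTE n12).
Qed.

Lemma word_base u : e o u -> word u = base u.
Proof.
by move=> /root_child[uo pu]; rewrite /word (depth_parent uo) pu depth_root.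
Qed.

Lemma initial_config : config initial_rotors.
Proof.
move=> v; rewrite /initial_rotors; case: (eqVneq v o) => [-> //|vo].
by case: (word v 0); [apply: parent_edge | have [] := child2P vo].
Qed.

Lemma initial_emits v : v != o -> emits v (word v) 0 initial_rotors.
Proof.
move=> vo; pose P v a n (r : V -> V) :=
  [/\ v != o, a = word v, n = 0 & r = initial_rotors].
apply: (@emits_coind P) => // {vo}v _ _ _ vo [_ -> -> ->].
have [n1 n2 n12 _ _] := neighbors vo.
have [c1 _ _] := child1P vo; have [c2 _ _] := child2P vo.
(* No child has produced a letter; the leading 0 counted by [~~ a 0] matches the rotor being away
   from the parent. *)
exists 0, 0; rewrite !ones0 /initial_rotors (negbTE vo) -word_child1 // -word_child2 //.
split; try by left.
  by case: (word v 0); rewrite eq_sym ?(negbTE n1) ?(negbTE n12).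
by case: (word v 0); rewrite ?eqxx ?n2.
Qed.

End InitialRotors.

(** * The three branches at the origin *)

Section RootCycle.

Variables (w0 : V) (w0P : e o w0).

(** The neighbor entered by chip [j]: the rotor at [o] starts at [w0] and advances before each chip
    moves, whence [j.+1]. *)
Definition root_branch j : V := iter j.+1 (next o) w0.

Lemma root_branch_edge j : e o (root_branch j).
Proof. by apply: (iter_orbit (P := e o)) w0P => u; apply: (nextP o).1. Qed.

Lemma root_branchP j : root_branch j != o /\ parent (root_branch j) = o.
Proof. exact/root_child/root_branch_edge. Qed.

Lemma root_branch_mod k : root_branch k = root_branch (k %% 3).
Proof.
have [_ c _] := next_3cycle nextP (degree3 o) w0P.
rewrite {1}(divn_eq k 3) /root_branch -addnS addnC iterD; congr iter.
by elim: (k %/ 3) => // q IH; rewrite mulSn iterD IH /= c.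
Qed.

Lemma root_branch_inj i j : i < 3 -> j < 3 -> root_branch i = root_branch j -> i = j.
Proof.
have [U c _] := next_3cycle nextP (degree3 o) w0P.
move: U; rewrite /= !inE !negb_or !andbT => /andP[/andP[n1 n2] n3].
have {}n1 := negbTE n1; have {}n2 := negbTE n2; have {}n3 := negbTE n3.
case: i => [|[|[|]]] //; case: j => [|[|[|]]] // _ _ /eqP;
  by rewrite /root_branch /= ?c ?n1 ?n2 ?n3 // eq_sym ?n1 ?n2 ?n3.
Qed.

Lemma root_branch_off i j x : i < 3 -> j < 3 -> i != j ->
  branch (root_branch i) x -> ~~ branch (root_branch j) x.
Proof.
move=> i3 j3 ij; have [ui pi] := root_branchP i; have [uj pj] := root_branchP j.
apply: branch_disjoint => //; first by rewrite pi.
by apply: contraNneq ij => /(root_branch_inj i3 j3) ->.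
Qed.

Lemma chipP k r b r' : config r -> r o = iter k (next o) w0 ->
  (escapes next o r <-> b = true) /\ configuration_after next o r r' <->
  outcome (root_branch k) (upd r o (root_branch k)) b r'.
Proof. by move=> rP ro; rewrite configuration_afterP // ro. Qed.

Lemma chip_rotors k r b r' : config r -> r o = iter k (next o) w0 ->
  outcome (root_branch k) (upd r o (root_branch k)) b r' ->
  [/\ config r', r' o = iter k.+1 (next o) w0 &
      forall j x, j < 3 -> j != k %% 3 -> branch (root_branch j) x -> r' x = r x].
Proof.
move=> rP ro out; have [uo pu] := root_branchP k.
have r1P : config (upd r o (root_branch k)).
  exact: config_upd (root_branch_edge k).
split; first exact: outcome_config out r1P.
  by rewrite (outcome_frame out) ?upd_eq ?branch_root.
move=> j x j3 jk jx; have [jo _] := root_branchP j.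
rewrite (outcome_frame out) // ?upd_neq //.
  by apply: contraTneq jx => ->; apply: branch_root.
by rewrite root_branch_mod; apply: root_branch_off jx => //; rewrite ltn_mod.
Qed.

End RootCycle.

(** * From escape sequences to residue words and back *)

Lemma escape_sequence_feed (w0 : V) (rs : nat -> V -> V) (a : seq bool) :
  e o w0 -> config (rs 0) -> rs 0 o = w0 ->
  (forall k, k < size a -> (escapes next o (rs k) <-> nth false a k = true) /\
     configuration_after next o (rs k) (rs k.+1)) ->
  forall j, j < 3 -> feed (root_branch w0 j) (rs 0) (residue_word a j).
Proof.
move=> w0P r0P r0o rsP j j3.
have inv k : k <= size a -> config (rs k) /\ rs k o = iter k (next o) w0.
  elim: k => // k IH lt; have [rP ro] := IH (ltnW lt).
  by have /(chipP _ _ rP ro) /(chip_rotors w0P rP ro)[] := rsP k lt.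
suff H n k : k + n = size a -> feed (root_branch w0 j) (rs k)
    [seq nth false a i | i <- iota k n & i %% 3 == j] by apply: H.
elim: n k => [|n IH] k kn; first exact: feed_nil.
have lt : k < size a by lia.
have [rP ro] := inv k (ltnW lt).
have /(chipP _ _ rP ro) out := rsP k lt.
have [_ _ fr] := chip_rotors w0P rP ro out.
have {IH} F := IH k.+1 ltac:(lia).
(* A chip of another residue does not touch this branch. *)
rewrite /=; have [kj|kj] := eqVneq (k %% 3) j; last first.
  by apply: feed_eq F => x jx; rewrite (fr j) // eq_sym.
rewrite /= root_branch_mod // kj in out *.
have [jo _] := root_branchP w0P j.
apply: feed_cons out F; first by apply: config_upd => //; apply: root_branch_edge.
by move=> x jx; rewrite upd_neq //; apply: contraTneq jx => ->; apply: branch_root.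
Qed.

Lemma sparse_escape_sequence (w0 : V) (a : seq bool) :
  e o w0 -> (forall j, j < 3 -> sparse (nth false (residue_word a j))) ->
  exists r, config r /\ escape_sequence next o r a.
Proof.
move=> w0P aP.
pose letters j := nth false (residue_word a j).
pose base u := letters (if u == root_branch w0 0 then 0
                        else if u == root_branch w0 1 then 1 else 2).
have baseE j : j < 3 -> base (root_branch w0 j) = letters j.
  move=> j3; have inj i := @root_branch_inj w0 w0P j i j3.
  rewrite /base; case: eqP => [/inj -> //|n0]; case: eqP => [/inj -> //|n1].
  by case: j j3 n0 n1 {inj} => [|[|[|]]].
(* [(k + 2 - j) %/ 3] is the number of chips before chip [k] whose index is congruent to [j] modulo
   3. *)
pose emitting k r := [/\ config r, r o = iter k (next o) w0 & forall j, j < 3 ->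
  emits (root_branch w0 j) (letters j) ((k + 2 - j) %/ 3) r].
(* The hypothesis stands under the existential so that choice yields a total successor function. *)
have step1 k r : exists r', emitting k r ->
    [/\ emitting k.+1 r', escapes next o r <-> nth false a k = true &
        configuration_after next o r r'].
  have [[rP ro E]|N] := EM (emitting k r); last by exists r.
  have k3 : k %% 3 < 3 by rewrite ltn_mod.
  have [uo _] := root_branchP w0P (k %% 3).
  have Ek := E _ k3.
  have kE : (k + 2 - k %% 3) %/ 3 = k %/ 3 by lia.
  rewrite kE in Ek.
  have rP1 := config_upd rP (root_branch_edge w0P (k %% 3)).
  have {}Ek : emits (root_branch w0 (k %% 3)) (letters (k %% 3)) (k %/ 3)
      (upd r o (root_branch w0 (k %% 3))).
    apply: emits_eq Ek => // x jx; rewrite upd_neq //.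
    by apply: contraTneq jx => ->; apply: branch_root.
  have [r' [out Ek']] := emits_outcome uo rP1 (aP _ k3) Ek.
  have ltr : nth false (residue_word a (k %% 3)) (k %/ 3) = nth false a k.
    by rewrite nth_residue_word // mulnC -divn_eq.
  rewrite ltr -root_branch_mod // in out.
  have [rP' ro' fr] := chip_rotors w0P rP ro out.
  exists r' => _; have /(chipP _ _ rP ro)[esc_iff after] := out; split=> //.
  split=> // j j3; have [->|jk] := eqVneq j (k %% 3).
    by have -> : (k.+1 + 2 - k %% 3) %/ 3 = (k %/ 3).+1 by lia.
  have -> : (k.+1 + 2 - j) %/ 3 = (k + 2 - j) %/ 3 by move/eqP: jk; lia.
  have [jo _] := root_branchP w0P j.
  by apply: emits_eq (E j j3) => // x jx; apply: fr jx.
have [nxt nxtP] := choice (fun p : nat * (V -> V) => step1 p.1 p.2).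
pose r0 := initial_rotors base w0.
pose fix rs k := if k is k'.+1 then nxt (k', rs k') else r0.
have rsP k : emitting k (rs k).
  elim: k => [|k IH]; last by have [] := nxtP (k, rs k) IH.
  split; first exact: initial_config.
    by rewrite /= /r0 /initial_rotors eqxx.
  move=> j j3; have [jo _] := root_branchP w0P j.
  have := initial_emits base w0 jo.
  rewrite word_base ?baseE //; last exact: root_branch_edge.
  by have -> : (0 + 2 - j) %/ 3 = 0 by lia.
exists r0; split; first by have [] := rsP 0.
by exists rs; split=> // k _; have [] := nxtP (k, rs k) (rsP k).
Qed.

End Branches.

Theorem theorem1p2 (V : eqType) (e : rel V) (o : V) (next : V -> V -> V)
    (treeV : ternary_tree e) (nextP : cyclic_ordering e next) (a : seq bool) :
  (exists r : V -> V,
     rotor_configuration e r /\ escape_sequence next o r a) <->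
  (forall j k : nat, j < 3 -> 2 <= k ->
     forall u : seq bool, infix u (residue_word a j) -> size u = 2 ^ k - 1 ->
       number_of_ones u <= 2 ^ (k - 1)).
Proof.
have [depth [parent [d0 pe dp eP]]] := rooting o treeV.
have deg3 := ternary_tree_regular treeV.
split=> [[r [rP [rs [/funext rs0 rsP]]]] j [|[|k]] // j3 _ u ua su|H].
  have eo : e o (rs 0 o) by rewrite rs0.
  have r0P : rotor_configuration e (rs 0) by rewrite rs0.
  have F := escape_sequence_feed d0 dp eP nextP deg3 eo r0P erefl rsP j3.
  have [jo _] := root_branchP eP nextP eo j.
  by rewrite subn1; apply: (feed_infix d0 pe dp eP nextP deg3 jo F ua su).
(* Any neighbor of [o] can be the initial rotor there. *)
have [s [_ size_s es]] := deg3 o.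
have eo : e o (head o s).
  by rewrite es; case: (s) size_s => // x l _; apply: mem_head.
apply: (sparse_escape_sequence d0 pe dp eP nextP deg3 eo) => j j3.
by apply: sparse_word => k k2; apply: H.
Qed.
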